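(* Let $\mathscr{A}$ be a $C^*$-algebra, let $\mathscr{X}$ be a Hilbert $\mathscr{A}$-module, and let $e_1,e_2,\dots,e_n\in\mathscr{X}$ be unit vectors (i.e. $\|e_i\|=1$ for all $i$) such that $\langle e_i,e_j\rangle=0$ for $1\le i\neq j\le n$. Then for every $x\in\mathscr{X}$, $$\sum_{i=1}^n|\langle e_i,x\rangle|^2\le |x|^2 .$$
   Context: A Hilbert $\mathscr{A}$-module over a $C^*$-algebra $\mathscr{A}$ is a complex linear space $\mathscr{X}$ that is a right $\mathscr{A}$-module with compatible scalar multiplication ($\lambda(xa)=x(\lambda a)=(\lambda x)a$), equipped with an $\mathscr{A}$-valued inner product $\langle\cdot,\cdot\rangle:\mathscr{X}\times\mathscr{X}\to\mathscr{A}$ satisfying: $\langle x,x\rangle\ge 0$, with $\langle x,x\rangle=0$ iff $x=0$; $\langle x,\lambda y+z\rangle=\lambda\langle x,y\rangle+\langle x,z\rangle$; $\langle x,ya\rangle=\langle x,y\rangle a$; $\langle x,y\rangle^*=\langle y,x\rangle$; and complete for the norm $\|x\|=\|\langle x,x\rangle\|^{1/2}$. (The inner product is thus linear in the second variable and conjugate-linear in the first.) For $x\in\mathscr{X}$, $|x|=\langle x,x\rangle^{1/2}\in\mathscr{A}$; for $a\in\mathscr{A}$, $|a|=(a^*a)^{1/2}$. Inequalities are in the usual order on self-adjoint elements of $\mathscr{A}$: $a\le b$ iff $b-a$ is positive. *)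

(* Defs.v *)
From HB Require Import structures.
From mathcomp Require Import all_boot all_order all_algebra.
From mathcomp Require Import complex.
From mathcomp Require Import all_classical all_reals all_analysis.

Set Implicit Arguments.
Unset Strict Implicit.
Unset Printing Implicit Defensive.

Import Order.TTheory GRing.Theory Num.Theory.
Import numFieldNormedType.Exports.

Local Open Scope classical_set_scope.
Local Open Scope complex_scope.
Local Open Scope ring_scope.

(* C*-algebras need not be unital, whereas the rings of MathComp are, so the
   product is specified on top of the underlying complex Banach space.  The
   norm of a normed module over R[i] takes its values in R[i], where
   0 <= z means that z is a nonnegative real. *)
HB.mixin Record isCstarAlgebra (R : realType) A
    of CompleteNormedModule R[i] A := {
  cmul : A -> A -> A ;
  cadj : A -> A ;
  cmulA : forall a b c, cmul a (cmul b c) = cmul (cmul a b) c ;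
  cmulDl : forall a b c, cmul (a + b) c = cmul a c + cmul b c ;
  cmulDr : forall a b c, cmul a (b + c) = cmul a b + cmul a c ;
  cmulZl : forall (z : R[i]) a b, cmul (z *: a) b = z *: cmul a b ;
  cmulZr : forall (z : R[i]) a b, cmul a (z *: b) = z *: cmul a b ;
  cadjK : forall a, cadj (cadj a) = a ;
  cadjD : forall a b, cadj (a + b) = cadj a + cadj b ;
  cadjZ : forall (z : R[i]) a, cadj (z *: a) = Num.conj z *: cadj a ;
  cadjM : forall a b, cadj (cmul a b) = cmul (cadj b) (cadj a) ;
  cnormM : forall a b, `|cmul a b| <= `|a| * `|b| :> R[i] ;
  cnorm_adj : forall a, `|cmul (cadj a) a| = `|a| ^+ 2 :> R[i]
}.

#[short(type="cstarAlgType")]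
HB.structure Definition CstarAlgebra (R : realType) :=
  {A of CompleteNormedModule R[i] A & isCstarAlgebra R A}.

Section CstarAlgebraDefs.
Context {R : realType} {A : cstarAlgType R}.
Implicit Types a b : A.

(* Product of the unitization: (a, z) stands for a + z 1. *)
Definition unz_mul (p q : A * R[i]) : A * R[i] :=
  (cmul p.1 q.1 + p.2 *: q.1 + q.2 *: p.1, p.2 * q.2).

Definition unz_one : A * R[i] := (0, 1).

Definition unz_invertible (p : A * R[i]) : Prop :=
  exists q, unz_mul p q = unz_one /\ unz_mul q p = unz_one.

(* The spectrum is taken in the unitization.  If A already has a unit, this
   differs from the spectrum in A at most by the point 0, which does not
   affect positivity. *)
Definition spectrum a : set R[i] :=
  [set z | ~ unz_invertible (a, - z)].

Definition selfadjoint a : Prop := cadj a = a.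

Definition cpositive a : Prop :=
  selfadjoint a /\ spectrum a `<=` [set z | 0 <= z].

Definition cle a b : Prop :=
  [/\ selfadjoint a, selfadjoint b & cpositive (b - a)].

(* A positive element has exactly one positive square root; the value is
   irrelevant (0) when there is none. *)
Definition csqrt a : A :=
  xget 0 [set b | cpositive b /\ cmul b b = a].

Definition cabs a : A := csqrt (cmul (cadj a) a).

Definition csqr a : A := cmul a a.

End CstarAlgebraDefs.

HB.mixin Record isHilbertModule (R : realType) (A : cstarAlgType R) X
    of GRing.Lmodule R[i] X := {
  hact : X -> A -> X ;
  hinner : X -> X -> A ;
  hactDl : forall x y a, hact (x + y) a = hact x a + hact y a ;
  hactDr : forall x a b, hact x (a + b) = hact x a + hact x b ;
  hactM : forall x a b, hact x (cmul a b) = hact (hact x a) b ;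
  hactZr : forall (z : R[i]) x a, z *: hact x a = hact x (z *: a) ;
  hactZl : forall (z : R[i]) x a, z *: hact x a = hact (z *: x) a ;
  hinner_ge0 : forall x, cpositive (hinner x x) ;
  hinner_eq0 : forall x, hinner x x = 0 <-> x = 0 ;
  hinner_linear : forall (z : R[i]) x y w,
    hinner x (z *: y + w) = z *: hinner x y + hinner x w ;
  hinner_act : forall x y a, hinner x (hact y a) = cmul (hinner x y) a ;
  hinner_adj : forall x y, cadj (hinner x y) = hinner y x ;
  hcomplete : forall u : nat -> X,
    (forall eps : R[i], 0 < eps ->
       \forall m & k \near \oo,
         sqrtC `|hinner (u m - u k) (u m - u k)| < eps) ->
    exists l : X, forall eps : R[i], 0 < eps ->
       \forall m \near \oo, sqrtC `|hinner (u m - l) (u m - l)| < eps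
}.

#[short(type="hilbertModType")]
HB.structure Definition HilbertModule (R : realType) (A : cstarAlgType R) :=
  {X of GRing.Lmodule R[i] X & isHilbertModule R A X}.

Section HilbertModuleDefs.
Context {R : realType} {A : cstarAlgType R} {X : hilbertModType A}.

Definition hnorm (x : X) : R[i] := sqrtC `|hinner x x|.

Definition habs (x : X) : A := csqrt (hinner x x).

End HilbertModuleDefs.

(* Main.v *)
Require Import Defs.
From HB Require Import structures.
From mathcomp Require Import all_boot all_order all_algebra.
From mathcomp Require Import complex.
From mathcomp Require Import all_classical all_reals all_analysis.
From mathcomp Require Import ring lra.

(** Bessel's inequality in a Hilbert C*-module.  Write [a_i] for [<e_i, x>],
    [p_i] for [<e_i, e_i>] and [y] for [x - \sum_i e_i a_i].  Expanding
    [<y, y>] with the orthogonality of the [e_i] gives ([bessel_identity])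

      [<x, x> - \sum_i a_i^* a_i = <y, y> + \sum_i a_i^* (1 - p_i) a_i].

    Unlike in a Hilbert space, [<e_i, e_i>] need not be [1]; it is only a
    self-adjoint element of norm [1].  Hence [1 - p_i] has a self-adjoint
    square root [k_i], the last summands are [(k_i a_i)^* (k_i a_i)]
    ([cpositive_contraction]), and the right-hand side is a sum of positive
    elements.

    What this uses about C*-algebras is that sums of positive elements and
    elements [a^* a] are positive, and that positive elements have positive
    square roots; the last point is also what gives [|a|^2] the value [a^* a].
    As positivity is defined by the spectrum in the unitization, these facts
    are proved there, by iteration and norm estimates.

    The key is a second description of positivity, [upos]: a self-adjoint [p]
    such that [`|t - p| <= t] for some real [t].  In this form closure under
    sums is the triangle inequality.  Square roots of [1 - h], for
    self-adjoint [h] of norm at most [1], come from the iteration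
    [q |-> (h + q^2) / 2] ([sqrt_one_sub]), whose increments are dominated by
    those of the same iteration on the number [1].  They show that squares of
    self-adjoint elements satisfy [upos]: if [h^2 + k^2 = 1] then [h + i k] is
    unitary ([bnd_real_sub_sq]).  That [upos] agrees with having a nonnegative
    spectrum rests on two facts.  If [p] satisfies [upos] and [s > 0], then
    [p + s] is invertible by the Neumann series ([upos_invertible]); the
    non-real part of the spectrum is handled by
    [(g - i y) (g + i y) = g^2 + y^2].  Conversely, if all [p + s] are
    invertible, a continuity argument on the norm of [r - p] applies
    ([upos_of_invertible]).  The positivity of [c^* c] ([upos_star_mul])
    follows Kaplansky: with [h = c^* c], [m = |h|] and [v = (m - h) / 2], the
    element [d = c v] satisfies [d^* d = - v^3 <= 0], which forces [d^* d = 0]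
    and then [v = 0]. *)

Set Implicit Arguments.
Unset Strict Implicit.
Unset Printing Implicit Defensive.

Import Order.TTheory GRing.Theory Num.Theory.
Import numFieldNormedType.Exports.

Local Open Scope complex_scope.
Local Open Scope ring_scope.

(** * The unitization as an algebra with involution *)

Section Unitization.
Context {R : realType} {A : cstarAlgType R}.

(** The multiplication is the one through which spectra are defined, so that
    [unz_invertible] is invertibility in the ring [unz]. *)
Definition unz : Type := (A * R[i]^o)%type.
HB.instance Definition _ := GRing.Lmodule.on unz.

Lemma cmul0r (a : A) : cmul 0 a = 0.
Proof. by apply: (@addrI _ (cmul 0 a)); rewrite -cmulDl !addr0. Qed.

Lemma cmulr0 (a : A) : cmul a 0 = 0.
Proof. by apply: (@addrI _ (cmul a 0)); rewrite -cmulDr !addr0. Qed.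

Lemma unz_mulA : associative (unz_mul : unz -> unz -> unz).
Proof.
move=> [a x] [b y] [c z]; congr pair => /=; last by rewrite mulrA.
rewrite !cmulDl !cmulDr !cmulZl !cmulZr !scalerDr !scalerA cmulA.
rewrite (mulrC z x) (mulrC z y) !addrA.
by rewrite [LHS](ACl (1*4*2*5*3*6*7)%AC).
Qed.

Lemma unz_mul1p : left_id (unz_one : unz) unz_mul.
Proof.
by move=> [a x]; congr pair => /=;
   rewrite ?cmul0r ?scale1r ?scaler0 ?addr0 ?add0r ?mul1r.
Qed.

Lemma unz_mulp1 : right_id (unz_one : unz) unz_mul.
Proof.
by move=> [a x]; congr pair => /=;
   rewrite ?cmulr0 ?scale1r ?scaler0 ?addr0 ?add0r ?mulr1.
Qed.

Lemma unz_mulDl : left_distributive (unz_mul : unz -> unz -> unz) +%R.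
Proof.
move=> [a x] [b y] [c z]; congr pair => /=; last by rewrite mulrDl.
rewrite cmulDl scalerDl scalerDr !addrA.
by rewrite (ACl (1*3*5*2*4*6)%AC).
Qed.

Lemma unz_mulDr : right_distributive (unz_mul : unz -> unz -> unz) +%R.
Proof.
move=> [a x] [b y] [c z]; congr pair => /=; last by rewrite mulrDr.
rewrite cmulDr scalerDl scalerDr !addrA.
by rewrite (ACl (1*3*5*2*4*6)%AC).
Qed.

Lemma unz_one_neq0 : (unz_one : unz) != 0.
Proof. by apply/eqP => -[] /eqP; rewrite oner_eq0. Qed.

HB.instance Definition _ := GRing.Zmodule_isNzRing.Build unz
  unz_mulA unz_mul1p unz_mulp1 unz_mulDl unz_mulDr unz_one_neq0.

Lemma unz_scalerAl (z : R[i]) (p q : unz) : z *: (p * q) = (z *: p) * q.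
Proof.
case: p q => [a x] [b y]; congr pair => /=; last exact: mulrA.
by rewrite !scalerDr cmulZl !scalerA [y * z]mulrC.
Qed.
HB.instance Definition _ := GRing.Lmodule_isLalgebra.Build R[i] unz unz_scalerAl.

Lemma unz_scalerAr (z : R[i]) (p q : unz) : z *: (p * q) = p * (z *: q).
Proof.
case: p q => [a x] [b y]; congr pair => /=.
  by rewrite !scalerDr cmulZr !scalerA [x * z]mulrC.
exact: mulrCA.
Qed.
HB.instance Definition _ := GRing.Lalgebra_isAlgebra.Build R[i] unz unz_scalerAr.

Definition ustar (p : unz) : unz := (cadj p.1, Num.conj p.2).
Definition emb (a : A) : unz := (a, 0).
(** [A] is an ideal of the unitization: [uact p b] is the product [p b]. *)
Definition uact (p : unz) (b : A) : A := cmul p.1 b + p.2 *: b.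

Local Notation "p ^#" := (ustar p) (at level 2, format "p ^#").
Implicit Types (p q h k : unz) (a b c : A) (z : R[i]) (r s t : R).

Lemma unz_invertibleP p :
  unz_invertible p <-> exists q : unz, p * q = 1 /\ q * p = 1.
Proof. by []. Qed.

Lemma ustarK p : p^#^# = p.
Proof. by case: p => a x; rewrite /ustar /= cadjK conjCK. Qed.

Lemma ustarD p q : (p + q)^# = p^# + q^#.
Proof. by congr pair; rewrite /= ?cadjD ?rmorphD. Qed.

Lemma ustarZ z p : (z *: p)^# = Num.conj z *: p^#.
Proof. by congr pair; rewrite /= ?cadjZ ?rmorphM. Qed.

Lemma conj_real r : Num.conj (r%:C) = r%:C.
Proof. by apply: conj_Creal; apply/complex_realP; exists r. Qed.

Lemma ustarZr r p : (r%:C *: p)^# = r%:C *: p^#.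
Proof. by rewrite ustarZ conj_real. Qed.

Lemma ustarN p : (- p)^# = - p^#.
Proof. by rewrite -scaleN1r ustarZ rmorphN rmorph1 scaleN1r. Qed.

Lemma ustarB p q : (p - q)^# = p^# - q^#.
Proof. by rewrite ustarD ustarN. Qed.

Lemma ustarM p q : (p * q)^# = q^# * p^#.
Proof.
congr pair => /=; last by rewrite rmorphM mulrC.
by rewrite !cadjD cadjM !cadjZ addrAC.
Qed.

Lemma cadj0 : cadj (0 : A) = 0.
Proof. by have := cadjZ 0 (0 : A); rewrite rmorph0 !scale0r. Qed.

Lemma ustar0 : (0 : unz)^# = 0.
Proof. by rewrite /ustar /= cadj0 rmorph0. Qed.

Lemma ustar1 : (1 : unz)^# = 1.
Proof. by rewrite /ustar /= cadj0 rmorph1. Qed.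

Lemma ustar_emb a : (emb a)^# = emb (cadj a).
Proof. by rewrite /ustar /= rmorph0. Qed.

Lemma embM a b : emb (cmul a b) = emb a * emb b.
Proof. by congr pair; rewrite /= ?mulr0 ?scale0r ?addr0. Qed.

Lemma embD a b : emb (a + b) = emb a + emb b.
Proof. by congr pair; rewrite /= addr0. Qed.

Lemma embN a : emb (- a) = - emb a.
Proof. by congr pair; rewrite /= oppr0. Qed.

Lemma embZ z a : emb (z *: a) = z *: emb a.
Proof. by congr pair; rewrite /= scaler0. Qed.

Lemma emb_inj : injective emb.
Proof. by move=> a b []. Qed.

Lemma emb_uact p b : emb (uact p b) = p * emb b.
Proof. by congr pair; rewrite /= ?mulr0 ?scale0r ?addr0. Qed.

Lemma uactM p q b : uact (p * q) b = uact p (uact q b).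
Proof. by apply: emb_inj; rewrite !emb_uact mulrA. Qed.

Lemma uactDl p q b : uact (p + q) b = uact p b + uact q b.
Proof. by apply: emb_inj; rewrite embD !emb_uact mulrDl. Qed.

Lemma uactZl z p b : uact (z *: p) b = z *: uact p b.
Proof. by apply: emb_inj; rewrite embZ !emb_uact scalerAl. Qed.

Lemma uact1 b : uact 1 b = b.
Proof. by apply: emb_inj; rewrite emb_uact mul1r. Qed.

(** The C*-identity gives [|a|^2 <= |a^*| |a|]; apply this also to [a^*]. *)
Lemma cnorm_adjE a : `|cadj a| = `|a|.
Proof.
have le b : `|b| <= `|cadj b|.
  have [->|b0] := eqVneq b 0; first by rewrite normr0.
  by rewrite -(ler_pM2r (x := `|b|)) ?normr_gt0 // -expr2 -cnorm_adj cnormM.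
by apply/eqP; rewrite eq_le le -{2}(cadjK a) le.
Qed.

(** * Norm bounds in the unitization *)

(** The norm bound [`|p| <= r] in the unitization.  The operator norm on [A]
    alone is only a seminorm on [unz] when [A] has a unit [u], because
    [(- u, 1)] acts as [0]; its maximum with the modulus of the scalar part is
    a C*-norm in all cases.  Phrasing it as a bound spares taking a supremum. *)
Definition bnd r p : Prop :=
  `|p.2 : R[i]| <= r%:C /\ forall b, `|uact p b| <= r%:C * `|b|.

Lemma bnd_ge0 r p : bnd r p -> 0 <= r.
Proof. by move=> [+ _] => /(le_trans (normr_ge0 _)); rewrite ler0c. Qed.

Lemma bnd_le r s p : r <= s -> bnd r p -> bnd s p.
Proof.
rewrite -lecR => rs [h1 h2]; split; first exact: le_trans rs.
by move=> b; apply: le_trans (h2 b) _; apply: ler_wpM2r.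
Qed.

Lemma bndD r s p q : bnd r p -> bnd s q -> bnd (r + s) (p + q).
Proof.
move=> [h1 h2] [h3 h4]; split.
  by apply: le_trans (ler_normD _ _) _; rewrite rmorphD lerD.
move=> b; rewrite uactDl rmorphD mulrDl.
by apply: le_trans (ler_normD _ _) _; rewrite lerD.
Qed.

Lemma bndZ z s p r : `|z| <= s%:C -> bnd r p -> bnd (s * r) (z *: p).
Proof.
move=> zs [h1 h2]; split; first by rewrite normrM rmorphM ler_pM.
by move=> b; rewrite uactZl normrZ rmorphM -mulrA ler_pM.
Qed.

Lemma normCr r : `|r%:C| = `|r|%:C :> R[i].
Proof.
have [r0|r0] := leP 0 r; first by rewrite !ger0_norm ?ler0c.
by rewrite !ltr0_norm ?rmorphN // ltcE /= eqxx.
Qed.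

Lemma bndZr s p r : 0 <= s -> bnd r p -> bnd (s * r) (s%:C *: p).
Proof. by move=> s0; apply: bndZ; rewrite normCr ger0_norm. Qed.

Lemma bndN r p : bnd r p -> bnd r (- p).
Proof.
move=> h; rewrite -scaleN1r -[r]mul1r; apply: bndZ h.
by rewrite normrN1 rmorph1.
Qed.

Lemma bndB r s p q : bnd r p -> bnd s q -> bnd (r + s) (p - q).
Proof. by move=> hp /bndN; apply: bndD. Qed.

Lemma bndM r s p q : bnd r p -> bnd s q -> bnd (r * s) (p * q).
Proof.
move=> hp hq; have r0 := bnd_ge0 hp; case: hp hq => [h1 h2] [h3 h4].
split; first by rewrite normrM rmorphM ler_pM.
move=> b; rewrite uactM rmorphM -mulrA.
by apply: le_trans (h2 _) _; rewrite ler_wpM2l // ler0c.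
Qed.

Lemma bnd1 : bnd 1 1.
Proof.
split; first by rewrite normr1 rmorph1.
by move=> b; rewrite uact1 rmorph1 mul1r.
Qed.

Lemma bnd0 : bnd 0 0.
Proof. by have := bndZr (lexx 0) bnd1; rewrite mul0r rmorph0 scale0r. Qed.

Lemma real_norm (V : normedZmodType R[i]) (v : V) : exists r, `|v| = r%:C.
Proof. by have /complex_realP := normr_real v. Qed.

Lemma bnd_pair r s p : `|p.1| <= r%:C -> `|p.2 : R[i]| <= s%:C -> bnd (r + s) p.
Proof.
move=> h1 h2; rewrite /bnd rmorphD; split.
  by rewrite ler_wpDl // (le_trans _ h1).
move=> b; rewrite mulrDl (le_trans (ler_normD _ _)) // lerD //.
  by rewrite (le_trans (cnormM _ _)) // ler_wpM2r.
by rewrite normrZ ler_wpM2r.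
Qed.

Lemma bnd_exists p : exists2 r, 0 < r & bnd r p.
Proof.
have [r hr] := real_norm p.1; have [s hs] := real_norm (p.2 : R[i]).
have r0 : 0 <= r by rewrite -ler0c -hr.
have s0 : 0 <= s by rewrite -ler0c -hs.
exists (r + s + 1); first by lra.
by apply: (@bnd_le (r + s)); [lra | apply: bnd_pair; rewrite ?hr ?hs].
Qed.

(** With [b = p.1^*] the C*-identity reads [`|p.1| `|b| = `|p.1 b|], and
    [p.1 b] differs from [p b] by a scalar multiple of [b].  Hence [bnd]
    controls both coordinates, and limits can be taken in them. *)
Lemma bnd_fst r p : bnd r p -> `|p.1| <= (2 * r)%:C.
Proof.
move=> [h1 h2]; have [r1|r1] := eqVneq p.1 0.
  by rewrite r1 normr0 ler0c mulr_ge0 // (bnd_ge0 (conj h1 h2)).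
have n0 : 0 < `|cadj p.1| by rewrite cnorm_adjE normr_gt0.
rewrite -(ler_pM2r n0) {1}cnorm_adjE -expr2 -{1}(cnorm_adjE p.1) -cnorm_adj cadjK.
have -> : cmul p.1 (cadj p.1) = uact p (cadj p.1) - p.2 *: cadj p.1.
  by rewrite addrK.
apply: le_trans (ler_normB _ _) _.
rewrite mulr_natl rmorphMn mulr2n mulrDl lerD // normrZ.
by rewrite ler_wpM2r.
Qed.

(** How equations between limits are proved: their difference is bounded by
    every [M * e]. *)
Lemma bnd_unique p M : (forall e, 0 < e -> bnd (M * e) p) -> p = 0.
Proof.
move=> H.
have M0 : 0 <= M by have := bnd_ge0 (H 1 ltr01); rewrite mulr1.
have H2 e : 0 < e -> bnd e p.
  move=> e0; apply: bnd_le (H (e / (M + 1)) _); last by rewrite divr_gt0; lra.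
  by rewrite mulrCA ger_pMr // ler_pdivrMr; lra.
have eq0 (V : normedZmodType R[i]) (v : V) :
    (forall e, 0 < e -> `|v| <= (2 * e)%:C) -> v = 0.
  have [r hr] := real_norm v; rewrite hr => Hv.
  apply/normr0_eq0; rewrite hr.
  have : r = 0.
    apply/eqP; rewrite eq_le; apply/andP; split; last by rewrite -ler0c -hr.
    rewrite leNgt; apply/negP => r0.
    by have := Hv (r / 4) ltac:(lra); rewrite lecR; lra.
  by move=> ->.
case: p {H} H2 => a z H2; congr pair; apply: eq0 => e e0.
  exact: bnd_fst (H2 _ e0).
by case: (H2 e e0) => h _; apply: le_trans h _; rewrite lecR; lra.
Qed.

Lemma bnd_closed r p : (forall e, 0 < e -> bnd (r + e) p) -> bnd r p.
Proof.
have cl (x y : R[i]) : x \is Num.real -> 0 <= y ->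
    (forall e, 0 < e -> x <= (r + e)%:C * y) -> x <= r%:C * y.
  move=> /complex_realP [x' ->] y0; have /complex_realP [y' yE] := ger0_real y0.
  move: y0; rewrite {}yE ler0c => y0 H; rewrite -rmorphM lecR.
  apply/ler_addgt0Pr => e e0.
  have := H (e / (y' + 1)) ltac:(rewrite divr_gt0 //; lra).
  rewrite -rmorphM lecR => /le_trans; apply.
  rewrite mulrDl lerD2l mulrAC ler_pdivrMr; last by lra.
  by rewrite ler_wpM2l //; lra.
move=> H; split; last by move=> b; apply: cl => // e /H [].
rewrite -[_%:C]mulr1; apply: cl => // e /H [h _]; by rewrite mulr1.
Qed.

(** Same argument as for [cnorm_adjE]: [`|p^* b|^2 <= `|b| `|p p^* b|]. *)
Lemma bnd_ustar r p : bnd r p -> bnd r p^#.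
Proof.
move=> [h1 h2]; split; first by rewrite norm_conjC.
move=> b; have [->|n0] := eqVneq (uact p^# b) 0.
  by rewrite normr0 mulr_ge0 // ler0c (bnd_ge0 (conj h1 h2)).
rewrite -(ler_pM2r (x := `|uact p^# b|)) ?normr_gt0 // -expr2 -cnorm_adj.
have -> : cmul (cadj (uact p^# b)) (uact p^# b) =
    cmul (cadj b) (uact p (uact p^# b)).
  apply: emb_inj; rewrite !embM -ustar_emb !emb_uact ustarM ustarK ustar_emb.
  by rewrite !mulrA.
apply: le_trans (cnormM _ _) _; rewrite cnorm_adjE [_%:C * _]mulrC -mulrA.
by rewrite ler_wpM2l.
Qed.

(** The C*-identity of the unitization, from
    [`|p b|^2 = `|b^* p^* p b| <= `|b| `|p^* p b|]. *)
Lemma bnd_sq r p : 0 <= r -> bnd (r ^+ 2) (p^# * p) -> bnd r p.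
Proof.
move=> r0 [h1 h2]; have rC : 0 <= r%:C :> R[i] by rewrite ler0c.
split.
  rewrite -(ler_pXn2r (n := 2)) ?nnegrE // -[X in _ <= X]rmorphXn.
  by move: h1; rewrite /= mulrC -normCK normrX normr_id.
move=> b; rewrite -(ler_pXn2r (n := 2)) ?nnegrE ?mulr_ge0 // -cnorm_adj.
have -> : cmul (cadj (uact p b)) (uact p b) = cmul (cadj b) (uact (p^# * p) b).
  apply: emb_inj; rewrite !embM -ustar_emb !emb_uact ustarM ustar_emb.
  by rewrite !mulrA.
apply: le_trans (cnormM _ _) _; rewrite cnorm_adjE exprMn [_ ^+ 2 * _]mulrC.
by rewrite expr2 -mulrA ler_wpM2l // mulrC -rmorphXn.
Qed.

End Unitization.

Local Notation "p ^#" := (ustar p) (at level 2, format "p ^#").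

(** * Limits in the unitization *)

Lemma cauchy_seq_limit (K : numFieldType) (V : completeNormedModType K)
    (u : nat -> V) :
  (forall e : K, 0 < e -> exists N, forall n, (N <= n)%N -> `|u n - u N| <= e) ->
  exists l, forall e : K, 0 < e ->
    exists N, forall n, (N <= n)%N -> `|l - u n| <= e.
Proof.
move=> H; have /cvg_ex [l ul] : cvgn u.
  apply: cauchy_cvg; apply: cauchy_exP => e e0.
  have [N HN] := H (e / 2) (divr_gt0 e0 (ltr0Sn _ 1)).
  exists (u N); exists N => // n /= Nn; rewrite -ball_normE /= distrC.
  by apply: le_lt_trans (HN n Nn) _; rewrite [ltRHS]splitr ltrDl divr_gt0.
exists l => e e0.
have /cvgrPdist_le /(_ e e0) [N _ HN] := ul.
by exists N => n /HN.
Qed.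

Section Completeness.
Context {R : realType} {A : cstarAlgType R}.
Implicit Types (p q h k : @unz R A) (r s t : R).

Lemma norm_le_ReIm (z : R[i]) : `|z| <= (`|complex.Re z| + `|complex.Im z|)%:C.
Proof.
rewrite {1}[z]complexE (le_trans (ler_normD _ _)) // rmorphD.
by rewrite normrM !normCr complexiE normCi mul1r.
Qed.

Lemma norm_Re_le (z : R[i]) r : `|z| <= r%:C -> `|complex.Re z| <= r.
Proof. by move=> /(le_trans (normc_ge_Re z)); rewrite lecR. Qed.

Lemma norm_Im_le (z : R[i]) r : `|z| <= r%:C -> `|complex.Im z| <= r.
Proof.
move=> h; rewrite -normrN -ReiNIm; apply: norm_Re_le.
by rewrite normrM complexiE normCi mulr1.
Qed.

(** Coordinatewise, with the scalar part split into real and imaginary parts. *)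
Lemma unz_cauchy_limit (q : nat -> @unz R A) :
  (forall e, 0 < e -> exists N, forall n, (N <= n)%N -> bnd e (q n - q N)) ->
  exists l, forall e, 0 < e ->
    exists N, forall n, (N <= n)%N -> bnd e (l - q n).
Proof.
move=> H.
have [|a Ha] := @cauchy_seq_limit _ A (fun n => (q n).1).
  move=> z z0; have /complex_realP [e ze] := gtr0_real z0.
  move: z0; rewrite {z}ze ltcR => e0.
  have [N HN] := H (e / 2) ltac:(lra).
  exists N => n /HN /bnd_fst; by rewrite mulrC divfK // gt_eqF.
have [|x Hx] := @cauchy_seq_limit _ R (fun n => complex.Re (q n).2).
  move=> e /H [N HN]; exists N => n /HN [+ _] => /norm_Re_le.
  by rewrite raddfB.
have [|y Hy] := @cauchy_seq_limit _ R (fun n => complex.Im (q n).2).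
  move=> e /H [N HN]; exists N => n /HN [+ _] => /norm_Im_le.
  by rewrite raddfB.
exists (a, x +i* y) => e e0.
have e3 : 0 < e / 3 by lra.
have [|N1 H1] := Ha (e / 3)%:C; first by rewrite ltcR.
have [N2 H2] := Hx _ e3; have [N3 H3] := Hy _ e3.
exists (maxn N1 (maxn N2 N3)) => n; rewrite !geq_max => /and3P [n1 n2 n3].
rewrite (_ : e = e / 3 + (e / 3 + e / 3)); last by field.
apply: bnd_pair; first exact: H1.
apply: le_trans (norm_le_ReIm _) _; rewrite lecR.
move: (H2 _ n2) (H3 _ n3); case: (q n) => [b [u v]] /= h2 h3.
by rewrite lerD.
Qed.

(** Convergence by domination: a sequence whose increments are bounded by
    those of a bounded real sequence [s] converges.  Both the Neumann series
    and the square root are obtained in this way, [s] being the same recursion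
    run on real numbers. *)
Lemma unz_dominated_limit (q : nat -> @unz R A) (s : nat -> R) B :
  (forall n, s n <= B) ->
  (forall n, bnd (s n.+1 - s n) (q n.+1 - q n)) ->
  exists l, forall e, 0 < e ->
    exists N, forall n, (N <= n)%N -> bnd e (l - q n).
Proof.
move=> sB qs; apply: unz_cauchy_limit => e e0.
have sE : has_sup (range s).
  by split; [exists (s 0%N), 0%N | exists B => _ [n _ <-]].
have [_ [N _ <-] HN] := sup_adherent e0 sE.
exists N => n Nn; apply: (@bnd_le _ _ (s n - s N)).
  have : s n <= sup (range s) by apply: ub_le_sup; [case: sE | exists n].
  by lra.
rewrite -(subnKC Nn); elim: (n - N)%N => [|m IH].
  by rewrite addn0 !subrr; exact: bnd0.
have -> : s (N + m.+1)%N - s N =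
    (s (N + m.+1)%N - s (N + m)%N) + (s (N + m)%N - s N).
  by ring.
have -> : q (N + m.+1)%N - q N =
    (q (N + m.+1)%N - q (N + m)%N) + (q (N + m)%N - q N).
  by rewrite addrA subrK.
by apply: bndD => //; rewrite addnS; exact: qs.
Qed.

End Completeness.

(** * Neumann series and square roots *)

Section SquareRoot.
Context {R : realType} {A : cstarAlgType R}.
Local Notation U := (@unz R A).
Implicit Types (p q h k c : U) (r s t : R).

Lemma scale_half_addrr p : (2^-1)%:C *: (p + p) = p.
Proof.
rewrite scalerDr -scalerDl -rmorphD (_ : 2^-1 + 2^-1 = 1); last by field.
by rewrite rmorph1 scale1r.
Qed.

Lemma unz_limit_comm (q : nat -> U) l c :
  (forall e, 0 < e -> exists N, forall n, (N <= n)%N -> bnd e (l - q n)) ->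
  (forall n, c * q n = q n * c) -> c * l = l * c.
Proof.
move=> ql cq; have [M M0 cM] := bnd_exists c.
apply/eqP; rewrite -subr_eq0; apply/eqP.
apply: (@bnd_unique _ _ _ (M + M)) => e /ql [N /(_ N (leqnn N)) lN].
have -> : c * l - l * c = c * (l - q N) - (l - q N) * c.
  by rewrite mulrBr mulrBl cq opprB addrA subrK.
by rewrite mulrDl; apply: bndB; [exact: bndM | rewrite mulrC; exact: bndM].
Qed.

Lemma unz_limit_star (q : nat -> U) l :
  (forall e, 0 < e -> exists N, forall n, (N <= n)%N -> bnd e (l - q n)) ->
  (forall n, (q n)^# = q n) -> l^# = l.
Proof.
move=> ql sq; apply/eqP; rewrite -subr_eq0; apply/eqP.
apply: (@bnd_unique _ _ _ 2) => e /ql [N /(_ N (leqnn N)) lN].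
have -> : l^# - l = (l - q N)^# - (l - q N).
  by rewrite ustarB sq opprB addrA subrK.
by rewrite mulrDl mul1r; apply: bndB => //; exact: bnd_ustar.
Qed.

(** The inverse is the limit of [q |-> 1 + p q].  This gives a right inverse
    only; since [p] is self-adjoint, its adjoint is a left inverse. *)
Lemma neumann p r : p^# = p -> bnd r p -> r < 1 -> unz_invertible (1 - p : U).
Proof.
move=> ps pr r1; have r0 := bnd_ge0 pr.
pose q n : U := iter n (fun x => 1 + p * x) 0.
pose s n : R := iter n (fun x => 1 + r * x) 0.
have sB n : s n <= (1 - r)^-1.
  elim: n => [|n IH] /=; first by rewrite invr_ge0; lra.
  have -> : (1 - r)^-1 = 1 + r * (1 - r)^-1 by field; rewrite subr_eq0 gt_eqF.
  by rewrite lerD2l ler_wpM2l.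
have qs n : bnd (s n.+1 - s n) (q n.+1 - q n).
  elim: n => [|n IH]; first by rewrite /= !mulr0 !addr0 !subr0; exact: bnd1.
  have -> : s n.+2 - s n.+1 = r * (s n.+1 - s n) by rewrite /=; ring.
  have -> : q n.+2 - q n.+1 = p * (q n.+1 - q n).
    by rewrite mulrBr /= opprD addrACA subrr add0r.
  exact: bndM.
have [l Hl] := unz_dominated_limit sB qs.
have lR : (1 - p) * l = 1.
  apply/eqP; rewrite mulrBl mul1r subr_eq -subr_eq0; apply/eqP.
  apply: (@bnd_unique _ _ _ (1 + r)) => e /Hl [N HN].
  have -> : l - (1 + p * l) = (l - q N.+1) - p * (l - q N).
    by rewrite mulrBr opprB /= opprD [RHS]addrA !opprD !addrA subrK.
  rewrite mulrDl mul1r; apply: bndB; first exact: HN.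
  by apply: bndM => //; exact: HN.
have lL : l^# * (1 - p) = 1.
  by rewrite -[LHS]ustarK ustarM ustarB ustar1 ustarK ps lR ustar1.
have ll : l^# = l by rewrite -[LHS]mulr1 -lR mulrA lL mul1r.
apply/unz_invertibleP; exists l; split; first exact: lR.
by rewrite -{1}ll; exact: lL.
Qed.

(** The equation [(1 - l)^2 = 1 - h] says that [l = (h + l^2) / 2], so [l] is
    sought by iterating [q |-> (h + q^2) / 2] from [0].  All iterates are
    polynomials in [h], hence commute, and the increments factor as
    [(q_{n+1} + q_n) (q_{n+1} - q_n) / 2]; by induction they are bounded by the
    increments of the iteration for [h = 1], which stays below [1].  The bound
    on [1 - k] is what makes the root [k] positive, and commutation with
    everything that commutes with [h] passes to the limit. *)
Lemma sqrt_one_sub h : h^# = h -> bnd 1 h ->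
  exists k, [/\ k^# = k, k * k = 1 - h, bnd 1 (1 - k) &
    forall c, c * h = h * c -> c * k = k * c].
Proof.
move=> hs h1.
pose q n : U := iter n (fun x => (2^-1)%:C *: (h + x * x)) 0.
pose s n : R := iter n (fun x => 2^-1 * (1 + x * x)) 0.
have s01 n : 0 <= s n <= 1 by elim: n => [|n IH] /=; nra.
have qs n : (q n)^# = q n.
  elim: n => [|n IH] /=; first exact: ustar0.
  by rewrite ustarZr ustarD ustarM hs IH.
have qC c : c * h = h * c -> forall n, c * q n = q n * c.
  move=> ch; elim=> [|n IH] /=; first by rewrite mulr0 mul0r.
  by rewrite -scalerAr -scalerAl mulrDr mulrDl ch !mulrA IH -!mulrA IH.
have qq m n : q m * q n = q n * q m by exact: qC _ (esym (qC h erefl m)) n.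
have qB n : bnd (s n) (q n).
  elim: n => [|n IH] /=; first exact: bnd0.
  apply: bndZr; first by lra.
  by apply: bndD => //; exact: bndM.
have dq n : bnd (s n.+1 - s n) (q n.+1 - q n).
  elim: n => [|n IH].
    have -> : q 1%N - q 0%N = (2^-1)%:C *: h by rewrite /= mulr0 addr0 subr0.
    have -> : s 1%N - s 0%N = 2^-1 * 1 by rewrite /=; ring.
    by apply: bndZr => //; lra.
  have -> : s n.+2 - s n.+1 = 2^-1 * ((s n.+1 + s n) * (s n.+1 - s n)).
    by rewrite /=; ring.
  have -> : q n.+2 - q n.+1 =
      (2^-1)%:C *: ((q n.+1 + q n) * (q n.+1 - q n)).
    rewrite mulrDl !mulrBr (qq n n.+1) addrA subrK.
    by rewrite [LHS]/= -scalerBr opprD addrACA subrr add0r.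
  by apply: bndZr; [lra | apply: bndM => //; exact: bndD].
have [l Hl] := unz_dominated_limit (fun n => (andP (s01 n)).2) dq.
have l1 : bnd 1 l.
  apply: bnd_closed => e /Hl [N /(_ N (leqnn N)) HN].
  rewrite -[l](subrK (q N)) addrC; apply: bndD => //.
  by apply: bnd_le (qB N); case/andP: (s01 N).
have lE : l = (2^-1)%:C *: (h + l * l).
  apply/eqP; rewrite -subr_eq0; apply/eqP.
  apply: (@bnd_unique _ _ _ 2) => e /Hl [N HN].
  have -> : l - (2^-1)%:C *: (h + l * l) = (l - q N.+1) -
     (2^-1)%:C *: (l * (l - q N) + (l - q N) * q N).
    rewrite mulrBr mulrBl addrA subrK /=.
    rewrite -[RHS]addrA -opprD -scalerDr; congr (_ - _ *: _).
    by rewrite -addrA; congr (_ + _); rewrite addrC subrK.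
  have -> : 2 * e = e + 2^-1 * (1 * e + e * 1) by field.
  apply: bndB; first exact: HN.
  have HN' := HN N (leqnn N).
  apply: bndZr; first by lra.
  apply: bndD; first exact: bndM.
  by apply: bndM => //; apply: bnd_le (qB N); case/andP: (s01 N).
exists (1 - l); split.
- by rewrite ustarB ustar1 (unz_limit_star Hl).
- have ll : l * l = l + l - h.
    by rewrite {3 4}lE -scalerDr scale_half_addrr [h + _]addrC addrK.
  by rewrite mulrBl mul1r mulrBr mulr1 opprB ll [_ - h - l]addrAC addrK addrA
    subrK.
- by rewrite subKr.
- move=> c ch; rewrite mulrBr mulrBl mulr1 mul1r; congr (_ - _).
  exact: unz_limit_comm Hl (qC c ch).
Qed.

End SquareRoot.

(** * Positivity through norm bounds *)

Lemma imaginary_unit (R : realType) : exists w : R[i],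
  [/\ w * w = -1, Num.conj w = - w & `|w| = 1].
Proof. by exists 'i; rewrite -expr2 sqrCi conjCi normCi. Qed.

Section Positivity.
Context {R : realType} {A : cstarAlgType R}.
Local Notation U := (@unz R A).
Implicit Types (p q h k c : U) (r s t : R).

Local Notation "r %:U" := (r%:C *: (1 : U)) (at level 2, format "r %:U").

(** A self-adjoint [p] has its spectrum in [[0, +oo[] iff [`|t - p| <= t] for
    one (equivalently, every large enough) [t]; in this form positivity is
    visibly stable under sums. *)
Definition upos p : Prop := p^# = p /\ exists t, bnd t (t%:U - p).

Lemma ustar_real r : r%:U^# = r%:U.
Proof. by rewrite ustarZr ustar1. Qed.

Lemma real_unzD r s : (r + s)%:U = r%:U + s%:U.
Proof. by rewrite rmorphD scalerDl. Qed.

Lemma real_unzB r s : (r - s)%:U = r%:U - s%:U.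
Proof. by rewrite rmorphB scalerBl. Qed.

Lemma real_unzM r s : (r * s)%:U = r%:C *: s%:U.
Proof. by rewrite rmorphM scalerA. Qed.

Lemma bnd_real r : 0 <= r -> bnd r r%:U.
Proof. by move=> r0; rewrite -{1}[r]mulr1; apply: bndZr bnd1. Qed.

Lemma scalerCK r p : r != 0 -> r%:C *: (r^-1%:C *: p) = p.
Proof. by move=> r0; rewrite scalerA -rmorphM divff // rmorph1 scale1r. Qed.

Lemma bnd_real_sub_le r s p : r <= s -> bnd r (r%:U - p) -> bnd s (s%:U - p).
Proof.
move=> rs h; have -> : s%:U - p = (s - r)%:U + (r%:U - p).
  by rewrite real_unzB addrA subrK.
rewrite -[X in bnd X](subrK r).
by apply: bndD => //; apply: bnd_real; lra.
Qed.

Lemma upos_add p q : upos p -> upos q -> upos (p + q).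
Proof.
move=> [ps [s hs]] [qs [t ht]]; split; first by rewrite ustarD ps qs.
by exists (s + t); rewrite real_unzD opprD addrACA; apply: bndD.
Qed.

Lemma upos_scale r p : 0 <= r -> upos p -> upos (r%:C *: p).
Proof.
move=> r0 [ps [s hs]]; split; first by rewrite ustarZr ps.
by exists (r * s); rewrite real_unzM -scalerBr; apply: bndZr.
Qed.

(** Scale to [t = 1] and let [k] be the square root of [1 - h^2], which
    commutes with [h].  Then [u = h + i k] satisfies [u^* u = h^2 + k^2 = 1],
    so [k = - i (u - u^* ) / 2] and [k^2 = 1 - h^2] have norm at most [1]. *)
Lemma bnd_real_sub_sq t h : 0 < t -> h^# = h -> bnd t h ->
  bnd (t ^+ 2) ((t ^+ 2)%:U - h * h).
Proof.
move=> t0 hs ht; pose g := t^-1%:C *: h.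
have gs : g^# = g by rewrite ustarZr hs.
have g1 : bnd 1 g.
  by rewrite -(mulVf (lt0r_neq0 t0)); apply: bndZr; rewrite ?invr_ge0 1?ltW.
have hE : h = t%:C *: g by rewrite scalerCK ?lt0r_neq0.
clearbody g.
have hh : h * h = (t ^+ 2)%:C *: (g * g).
  by rewrite hE -scalerAl -scalerAr scalerA -rmorphM -expr2.
have gg1 : bnd 1 (g * g) by rewrite -[X in bnd X]mulr1; apply: bndM.
have [|k [ks kk _ kC]] := @sqrt_one_sub R A (g * g) _ gg1.
  by rewrite ustarM gs.
have gk : g * k = k * g by apply: kC; rewrite mulrA.
have [w [ww wc wn]] := imaginary_unit R.
have u1 : bnd 1 (g + w *: k).
  apply: bnd_sq => //; rewrite expr1n.
  have -> : (g + w *: k)^# * (g + w *: k) = 1; last exact: bnd1.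
  have yy : (w *: k) * (w *: k) = - (1 - g * g).
    by rewrite -scalerAl -scalerAr scalerA ww kk scaleN1r.
  have gy : g * (w *: k) = (w *: k) * g by rewrite -scalerAr -scalerAl gk.
  rewrite ustarD gs ustarZ wc ks scaleNr mulrDr !mulrBl gy yy.
  by rewrite addrA subrK opprK addrC subrK.
have k1 : bnd 1 k.
  have -> : k = (- w * (2^-1)%:C) *: ((g + w *: k) - (g + w *: k)^#).
    rewrite ustarD gs ustarZ wc ks scaleNr opprB addrC addrA subrK -scalerDr.
    by rewrite scalerA mulrAC mulNr ww opprK mul1r scale_half_addrr.
  rewrite -[X in bnd X](_ : 2^-1 * (1 + 1) = 1); last by field.
  apply: bndZ; last by apply: bndB => //; exact: bnd_ustar.
  by rewrite normrM normrN wn mul1r normCr ger0_norm.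
rewrite hh -scalerBr -kk -[X in bnd X]mulr1; apply: bndZr.
  by rewrite exprn_ge0 ?ltW.
by rewrite -[X in bnd X]mulr1; apply: bndM.
Qed.

Lemma upos_sq h : h^# = h -> upos (h * h).
Proof.
move=> hs; split; first by rewrite ustarM hs.
by have [t t0 ht] := bnd_exists h; exists (t ^+ 2); apply: bnd_real_sub_sq.
Qed.

(** If [`|t - p| <= t], then [p / t = 1 - h] with [h = (t - p) / t] of norm at
    most [1]. *)
Lemma upos_sqrt p : upos p -> exists k,
  [/\ k^# = k, k * k = p, upos k & forall c, c * p = p * c -> c * k = k * c].
Proof.
move=> [ps [t0 ht0]].
have [t [tp ht]] : exists t, 0 < t /\ bnd t (t%:U - p).
  exists (t0 + 1); split; first by have := bnd_ge0 ht0; lra.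
  by apply: bnd_real_sub_le ht0; lra.
have tn : t != 0 by rewrite lt0r_neq0.
pose h : U := 1 - t^-1%:C *: p.
have h1 : bnd 1 h.
  have -> : h = t^-1%:C *: (t%:U - p).
    by rewrite scalerBr scalerA -rmorphM mulVf // rmorph1 scale1r.
  by rewrite -(mulVf tn); apply: bndZr; rewrite ?invr_ge0 1?ltW.
have [|k [ks kk k1 kC]] := sqrt_one_sub _ h1.
  by rewrite ustarB ustar1 ustarZr ps.
have st : Num.sqrt t * Num.sqrt t = t by rewrite -expr2 sqr_sqrtr // ltW.
exists ((Num.sqrt t)%:C *: k); split.
- by rewrite ustarZr ks.
- rewrite -scalerAl -scalerAr scalerA -rmorphM st kk /h opprB addrC subrK.
  exact: scalerCK.
- apply: upos_scale; first exact: sqrtr_ge0.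
  by split=> //; exists 1; rewrite rmorph1 scale1r.
- move=> c cp; rewrite -scalerAr -scalerAl kC //.
  by rewrite mulrBr mulrBl mulr1 mul1r -scalerAr -scalerAl cp.
Qed.

(** The bound in [upos] may be taken at any [r] above the norm of [p]: this is
    [bnd_real_sub_sq] for the square root of [p]. *)
Lemma upos_bnd r p : 0 < r -> upos p -> bnd r p -> bnd r (r%:U - p).
Proof.
move=> r0 /upos_sqrt [k [ks <- _ _]] pr.
have sr : Num.sqrt r ^+ 2 = r by rewrite sqr_sqrtr // ltW.
rewrite -{1 2}sr; apply: bnd_real_sub_sq => //; first by rewrite sqrtr_gt0.
by apply: bnd_sq; [exact: sqrtr_ge0 | rewrite sr ks].
Qed.

Lemma unz_invertibleZ r p : r != 0 ->
  unz_invertible p -> unz_invertible (r%:C *: p).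
Proof.
move=> r0 /unz_invertibleP [q [pq qp]]; apply/unz_invertibleP.
exists (r^-1%:C *: q); rewrite -!scalerAl -!scalerAr pq qp scalerCK //.
by rewrite scalerA -rmorphM mulVf // rmorph1 scale1r.
Qed.

(** [p + s = (t + s) (1 - (t - p) / (t + s))], and [t / (t + s) < 1]. *)
Lemma upos_invertible s p : 0 < s -> upos p -> unz_invertible (p + s%:U).
Proof.
move=> s0 [ps [t ht]]; have t0 := bnd_ge0 ht.
have ts : t + s != 0 by rewrite gt_eqF //; lra.
have -> : p + s%:U = (t + s)%:C *: (1 - (t + s)^-1%:C *: (t%:U - p)).
  by rewrite scalerBr scalerCK // rmorphD scalerDl opprB [RHS]addrC addrA subrK.
apply: unz_invertibleZ => //; apply: (@neumann _ _ _ ((t + s)^-1 * t)).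
- by rewrite ustarZr ustarB ustar_real ps.
- by apply: bndZr => //; rewrite invr_ge0; lra.
- by rewrite mulrC ltr_pdivrMr; lra.
Qed.

(** An invertible positive element is bounded below.  If [M] bounds the inverse
    [q] and [d = 1 / M], then [p - d = p (1 - d q)] is a product of two
    commuting squares. *)
Lemma upos_invertible_sub p : upos p -> unz_invertible p ->
  exists2 d, 0 < d & upos (p - d%:U).
Proof.
move=> pp /unz_invertibleP [q [pq qp]]; have [ps _] := pp.
have qs : q^# = q.
  have e : q^# * p = 1 by rewrite -[LHS]ustarK ustarM ustarK ps pq ustar1.
  by rewrite -[LHS]mulr1 -pq mulrA e mul1r.
have [M M0 qM] := bnd_exists q.
have Mn : M != 0 by rewrite lt0r_neq0.
exists M^-1; first by rewrite invr_gt0.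
have [c [cs cc _ cC]] := upos_sqrt pp.
have [||d [ds dd _ dC]] := @sqrt_one_sub R A (M^-1%:C *: q).
- by rewrite ustarZr qs.
- by rewrite -(mulVf Mn); apply: bndZr => //; rewrite invr_ge0 ltW.
have qc : q * c = c * q by apply: cC; rewrite pq qp.
have cd : c * d = d * c by apply: dC; rewrite -scalerAr -scalerAl qc.
have -> : p - M^-1%:U = (c * d) * (c * d).
  rewrite {2}cd mulrA -(mulrA c) dd mulrBr mulr1 mulrBl cc -scalerAr -scalerAl.
  by rewrite -mulrA qc mulrA cc pq.
by apply: upos_sq; rewrite ustarM cs ds cd.
Qed.

(** Let [r] bound [p] and let [v] be the norm of [r - p].  If [v > r], then
    [p + (v - r)] satisfies [upos] with the bound [v], and it is invertible;
    so a positive multiple [d] of the unit can still be subtracted, and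
    [`|r - p| <= v - d], a contradiction.  Thus [v <= r]. *)
Lemma upos_of_invertible p : p^# = p ->
  (forall s, 0 < s -> unz_invertible (p + s%:U)) -> upos p.
Proof.
move=> ps pinv; split=> //; have [r r0 pr] := bnd_exists p.
pose S := [set t | bnd t (r%:U - p)]%classic.
have S0 : S (r + r) by apply: bndB pr; apply: bnd_real; exact: ltW.
have Sge t : S t -> 0 <= t by exact: bnd_ge0.
have Sinf : has_inf S by split; [exists (r + r) | exists 0 => t /Sge].
pose v := inf S.
have Sv : bnd v (r%:U - p).
  apply: bnd_closed => e e0; have [t St tv] := inf_adherent e0 Sinf.
  exact: bnd_le (ltW tv) St.
exists r; have [vr|rv] := leP v r; first exact: bnd_le Sv.
have pv : upos (p + (v - r)%:U).
  split; first by rewrite ustarD ustar_real ps.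
  by exists v; rewrite real_unzB opprD opprB addrCA [v%:U + _]addrC subrK addrC.
have [|d0 d0p pd0] := upos_invertible_sub pv; first by apply: pinv; lra.
pose d := Num.min d0 (v - r).
have dp : 0 < d by rewrite lt_min d0p /=; lra.
have dd0 : d <= d0 by rewrite ge_min lexx.
have dvr : d <= v - r by rewrite ge_min lexx orbT.
have pd : upos (p + (v - r - d)%:U).
  have -> : p + (v - r - d)%:U = (p + (v - r)%:U - d0%:U) + (d0 - d)%:U.
    by rewrite !real_unzB [in RHS]addrA subrK addrA.
  apply: upos_add => //; split; first exact: ustar_real.
  by exists (d0 - d); rewrite subrr; apply: bnd_le bnd0; lra.
have : bnd (v - d) (r%:U - p).
  have -> : r%:U - p = (v - d)%:U - (p + (v - r - d)%:U).
    rewrite [in RHS]opprD addrCA -real_unzB addrC; congr (_%:U - p); by ring.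
  apply: upos_bnd => //; first by lra.
  rewrite (_ : v - d = r + (v - r - d)); last by ring.
  by apply: bndD pr _; apply: bnd_real; lra.
move=> /(ge_inf (proj2 Sinf)); rewrite -/v; lra.
Qed.

End Positivity.

(** * Positivity of [c^* c] *)

Section StarSquares.
Context {R : realType} {A : cstarAlgType R}.
Local Notation U := (@unz R A).
Implicit Types (p q h k c : U) (r s t : R).

Local Notation "r %:U" := (r%:C *: (1 : U)) (at level 2, format "r %:U").

Lemma star_mul_eq0 p : p^# * p = 0 -> p = 0.
Proof.
move=> pp; have p0 : bnd 0 p.
  by apply: bnd_sq => //; rewrite pp expr2 mul0r; exact: bnd0.
by apply: (@bnd_unique _ _ _ 1) => e e0; apply: bnd_le p0; rewrite mul1r ltW.
Qed.

(** If [h = k^2] and [- h = l^2], then [h^2 + (k l)^2 = 0], so that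
    [u = h + i k l] has [u^* u = 0]; hence [u = 0], and so is its real part. *)
Lemma upos_antisym h : upos h -> upos (- h) -> h = 0.
Proof.
move=> hp hn; have [hs _] := hp.
have [k [ks kk _ kC]] := upos_sqrt hp.
have [l [ls ll _ lC]] := upos_sqrt hn.
have kl : k * l = l * k by apply: lC; rewrite mulrN mulNr -kk mulrA.
have [w [ww wc _]] := imaginary_unit R.
pose y : U := w *: (k * l).
have yy : y * y = h * h.
  rewrite -scalerAl -scalerAr scalerA ww scaleN1r {2}kl mulrA -(mulrA k).
  by rewrite ll mulrN mulNr opprK -kk !mulrA.
have ys : y^# = - y by rewrite ustarZ wc ustarM ks ls -kl scaleNr.
have hy : h * y = y * h.
  rewrite -scalerAr -scalerAl; congr (_ *: _).
  have kh : k * h = h * k by rewrite -kk mulrA.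
  have lh : l * h = h * l by rewrite -[h]opprK -ll mulrN mulNr mulrA.
  by rewrite mulrA -kh -mulrA -lh mulrA.
clearbody y.
have u0 : h + y = 0.
  apply: star_mul_eq0; rewrite ustarD hs ys mulrDr !mulrBl hy yy.
  by rewrite addrA subrK subrr.
have u1 : h - y = 0 by rewrite -ys -{1}hs -ustarD u0 ustar0.
have e : (h + y) + (h - y) = h + h by rewrite addrACA subrr addr0.
by rewrite -[h]scale_half_addrr -e u0 u1 addr0 scaler0.
Qed.

(** Jacobson's identity: if [x] inverts [p q + s], then [(1 - q x p) / s]
    inverts [q p + s]. *)
Lemma unz_invertible_swap s p q : s != 0 ->
  unz_invertible (p * q + s%:U) -> unz_invertible (q * p + s%:U).
Proof.
move=> s0 /unz_invertibleP [x [ax xa]]; apply/unz_invertibleP.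
exists (s^-1%:C *: (1 - q * x * p)); split.
  rewrite -scalerAr mulrBr mulr1.
  have -> : (q * p + s%:U) * (q * x * p) = q * p.
    have -> : (q * p + s%:U) * (q * x * p) = q * ((p * q + s%:U) * x) * p.
      by rewrite !(mulrDl, mulrDr) -!scalerAl !mul1r -!scalerAr -scalerAl !mulrA.
    by rewrite ax mulr1.
  by rewrite addrC addKr scalerA -rmorphM mulVf // rmorph1 scale1r.
rewrite -scalerAl mulrBl mul1r.
have -> : (q * x * p) * (q * p + s%:U) = q * p.
  have -> : (q * x * p) * (q * p + s%:U) = q * (x * (p * q + s%:U)) * p.
    by rewrite !(mulrDl, mulrDr) -!scalerAr !mulr1 -!scalerAl !mulrA.
  by rewrite xa mulr1.
by rewrite addrC addKr scalerA -rmorphM mulVf // rmorph1 scale1r.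
Qed.

(** Half of [(c + c^* )^2 + (i (c - c^* ))^2], twice the sum of the squares of the
    real and imaginary parts of [c]. *)
Lemma upos_add_star_mul c : upos (c * c^# + c^# * c).
Proof.
have [w [ww wc _]] := imaginary_unit R.
have e1 : upos ((c + c^#) * (c + c^#)).
  by apply: upos_sq; rewrite ustarD ustarK addrC.
have e2 : upos ((w *: (c - c^#)) * (w *: (c - c^#))).
  by apply: upos_sq; rewrite ustarZ wc ustarB ustarK scaleNr -scalerN opprB.
rewrite -[X in upos X]scale_half_addrr.
have -> : (c * c^# + c^# * c) + (c * c^# + c^# * c) =
    (c + c^#) * (c + c^#) + (w *: (c - c^#)) * (w *: (c - c^#)).
  rewrite -scalerAl -scalerAr scalerA ww scaleN1r.
  have -> : (c + c^#) * (c + c^#) = (c * c + c^# * c^#) + (c * c^# + c^# * c).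
    by rewrite mulrDl !mulrDr [c^# * c + _]addrC addrACA.
  have -> : (c - c^#) * (c - c^#) = (c * c + c^# * c^#) - (c * c^# + c^# * c).
    by rewrite mulrBl !mulrBr opprB addrACA -opprD.
  by rewrite opprB [X in _ = X + _]addrC [RHS]addrACA subrr addr0.
by apply: upos_scale; [rewrite invr_ge0 | exact: upos_add].
Qed.

(** [c^* c <= 0] implies [c c^* <= 0], as both have the same spectrum apart
    from [0].  Since [c c^* + c^* c >= 0], also [c^* c >= 0]. *)
Lemma star_mul_opp_sq_eq0 c g : g^# = g -> c^# * c = - (g * g) -> g = 0.
Proof.
move=> gs cg.
have n : upos (- (c * c^#)).
  apply: upos_of_invertible; first by rewrite ustarN ustarM ustarK.
  move=> s s0; rewrite -mulNr.
  apply: unz_invertible_swap; first by rewrite gt_eqF.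
  by rewrite mulrN cg opprK; apply: upos_invertible => //; exact: upos_sq.
have gg : g * g = 0.
  apply: upos_antisym; first exact: upos_sq.
  have := upos_add n (upos_add_star_mul c).
  by rewrite addrA addNr add0r cg.
by apply: star_mul_eq0; rewrite gs.
Qed.

(** Kaplansky's argument.  Here [m] is a square root of [h^2] and
    [v = (m - h) / 2], the negative part of [h].  From [v^2 = m v] one gets
    [(c v)^* (c v) = v h v = - v^3], and [v^3 = m v^2 = (n v)^2] with [n] a
    square root of [m].  Writing [v^3] as a square shows it to be
    positive before [v] is known to be. *)
Lemma upos_star_mul c : upos (c^# * c).
Proof.
pose h : U := c^# * c; rewrite -/h.
have hs : h^# = h by rewrite ustarM ustarK.
have [m [ms mm mp mC]] := upos_sqrt (upos_sq hs).
have hm : h * m = m * h by apply: mC; rewrite mulrA.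
have [n [ns nn _ nC]] := upos_sqrt mp.
have hn : h * n = n * h by exact: nC.
have mn : m * n = n * m by exact: nC.
have [v [vs vE]] : exists v : U, v^# = v /\ v + v = m - h.
  exists ((2^-1)%:C *: (m - h)); split.
    by rewrite ustarZr ustarB ms hs.
  by rewrite -scalerDr scale_half_addrr.
have vC p : p * h = h * p -> p * m = m * p -> p * v = v * p.
  move=> ph pm; rewrite -[v]scale_half_addrr vE -scalerAr -scalerAl.
  by rewrite mulrBr mulrBl ph pm.
have mv : m * v = v * m by apply: vC.
have nv : n * v = v * n by apply: vC.
have vv : v * v = m * v.
  have e : (v + v) * (v + v) = (m * (v + v)) + (m * (v + v)).
    by rewrite vE mulrBl !mulrBr hm -mm opprB.
  have e2 : (v * v + v * v) + (v * v + v * v) = (m * v + m * v) + (m * v + m * v).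
    by move: e; rewrite mulrDl !mulrDr.
  rewrite -[LHS]scale_half_addrr -[X in _ *: X]scale_half_addrr e2.
  by rewrite !scale_half_addrr.
have gs : (n * v)^# = n * v by rewrite ustarM ns vs.
have gg : (n * v) * (n * v) = m * v * v.
  by rewrite {1}nv -mulrA (mulrA n) nn mulrA -mv.
have g0 : n * v = 0.
  apply: (@star_mul_opp_sq_eq0 (c * v)) => //.
  rewrite gg ustarM vs -(mulrA v) (mulrA c^#) -/h.
  have -> : h = m - (v + v) by rewrite vE subKr.
  by rewrite mulrBl mulrDl vv opprD addrA subrr add0r mulrN mulrA -mv.
have v2 : v * v = 0.
  apply: star_mul_eq0; rewrite ustarM vs mulrA {1}vv -gg g0.
  by rewrite mul0r mul0r.
have v0 : v = 0 by apply: star_mul_eq0; rewrite vs.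
have -> : h = m by apply/esym/eqP; rewrite -subr_eq0 -vE v0 addr0.
exact: mp.
Qed.

End StarSquares.

(** * Positive elements of a C*-algebra *)

Section CstarPositivity.
Context {R : realType} {A : cstarAlgType R}.
Implicit Types (p q : @unz R A) (a b : A) (r s : R).

Local Notation U := (@unz R A).
Local Notation "r %:U" := (r%:C *: (1 : U)) (at level 2, format "r %:U").

(** Used on [g^2 + y^2 = (g - i y) (g + i y)] to exclude non-real spectrum. *)
Lemma unz_invertible_factor p q : p * q = q * p ->
  unz_invertible (p * q) -> unz_invertible p.
Proof.
move=> pq /unz_invertibleP [x [pqx xpq]]; apply/unz_invertibleP.
have xqp : (x * q) * p = 1 by rewrite -mulrA -pq.
exists (q * x); split; first by rewrite mulrA.
have -> : q * x = x * q.
  by rewrite -[LHS]mul1r -xqp -!mulrA [p * _]mulrA pqx mulr1.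
exact: xqp.
Qed.

Lemma pair_emb a (z : R[i]) : (a, z) = emb a + z *: 1 :> U.
Proof.
congr pair; rewrite /= ?scaler0 ?addr0 // add0r; exact: esym (mulr1 z).
Qed.

(** Real points of the spectrum are dealt with by [upos_of_invertible] and
    [upos_invertible].  If [z = x + i y] with [y != 0], then [g = a - x] is
    self-adjoint and [g - i y] is a factor of [g^2 + y^2], which is invertible
    because [g^2] is positive. *)
Lemma cpositiveP a : cpositive a <-> upos (emb a).
Proof.
split=> [[sa sp]|pa].
  apply: upos_of_invertible; first by rewrite ustar_emb sa.
  move=> s s0; apply: contrapT; rewrite -pair_emb -[s%:C]opprK => /sp /=.
  by rewrite oppr_ge0 lecE /= leNgt s0 andbF.
have [sa _] := pa; split.
  by apply: (@emb_inj R A); rewrite -ustar_emb.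
move=> z /= Nz; apply: contrapT => z0; apply: Nz.
rewrite pair_emb.
have [x [y zE]] : exists x y : R, z = x%:C + 'i * y%:C.
  by exists (complex.Re z), (complex.Im z); rewrite -complexiE -complexE.
have [y0|y0] := eqVneq y 0.
  have -> : - z = (- x)%:C by rewrite zE y0 rmorph0 mulr0 addr0 rmorphN.
  apply: upos_invertible => //; rewrite oppr_gt0 ltNge; apply/negP => x0.
  by apply: z0; rewrite zE y0 rmorph0 mulr0 addr0 ler0c.
pose g : U := emb a - x%:U.
have gs : g^# = g by rewrite ustarB sa ustar_real.
have -> : emb a + (- z) *: (1 : U) = g - ('i * y%:C) *: (1 : U).
  by rewrite zE opprD scalerDl addrA !scaleNr.
clearbody g.
apply: (@unz_invertible_factor _ (g + ('i * y%:C) *: (1 : U))).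
  rewrite !(mulrDl, mulrDr, mulNr, mulrN) -!scalerAl -!scalerAr !mulr1 !mul1r.
  by rewrite -!addrA; congr (_ + _); rewrite addrCA.
have -> : (g - ('i * y%:C) *: (1 : U)) * (g + ('i * y%:C) *: (1 : U)) =
    g * g + (y ^+ 2)%:U.
  rewrite mulrDr !mulrBl -!scalerAl -!scalerAr !mulr1 !mul1r scalerA.
  have -> : 'i * y%:C * ('i * y%:C) = - (y ^+ 2)%:C :> R[i].
    by rewrite mulrACA -expr2 sqrCi mulN1r -rmorphM.
  by rewrite scaleNr opprK addrA subrK.
apply: upos_invertible; last exact: upos_sq.
by rewrite exprn_even_gt0.
Qed.

(** The root found in the unitization lies in [A], as the square of its scalar
    part is [0]. *)
Lemma csqr_csqrt a : cpositive a -> csqr (csqrt a) = a.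
Proof.
move=> /cpositiveP pa; have [k [_ kk kp _]] := upos_sqrt pa.
have k2 : k.2 = 0.
  by have /eqP := congr1 snd kk; rewrite /= mulf_eq0 orbb => /eqP.
have kE : k = emb k.1 by case: (k) k2 => b z /= ->.
have [|_ sq] := @xgetPex _ 0 [set b | cpositive b /\ cmul b b = a]%classic;
  last exact: sq.
exists k.1; split; first by apply/cpositiveP; rewrite -kE.
by apply: (@emb_inj R A); rewrite embM -kE.
Qed.

Lemma cpositive_star_mul a : cpositive (cmul (cadj a) a).
Proof. by apply/cpositiveP; rewrite embM -ustar_emb; exact: upos_star_mul. Qed.

Lemma cpositiveD a b : cpositive a -> cpositive b -> cpositive (a + b).
Proof.
move=> /cpositiveP pa /cpositiveP pb; apply/cpositiveP; rewrite embD.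
exact: upos_add.
Qed.

Lemma cpositive0 : cpositive (0 : A).
Proof.
rewrite -(cmul0r (cadj 0)) -[X in cmul X _]cadjK; exact: cpositive_star_mul.
Qed.

Lemma cpositive_sum (I : Type) (l : seq I) (F : I -> A) :
  (forall i, cpositive (F i)) -> cpositive (\sum_(i <- l) F i).
Proof.
by move=> H; elim/big_ind: _ => //; [exact: cpositive0 | exact: cpositiveD].
Qed.

(** [b] has norm at most [1], so [1 - b = k^2] in the unitization, and the
    element is [(k a)^* (k a)]. *)
Lemma cpositive_contraction a b : cadj b = b -> `|b| <= 1 ->
  cpositive (cmul (cadj a) (a - cmul b a)).
Proof.
move=> bs b1; have bE : bnd 1 (emb b).
  rewrite -[X in bnd X]addr0; apply: bnd_pair; first by rewrite rmorph1.
  by rewrite normr0 rmorph0.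
have [|k [ks kk _ _]] := sqrt_one_sub _ bE; first by rewrite ustar_emb bs.
apply/cpositiveP.
have -> : emb (cmul (cadj a) (a - cmul b a)) = (k * emb a)^# * (k * emb a).
  rewrite ustarM ks -mulrA (mulrA k) kk mulrBl mul1r -embM -embN -embD ustar_emb.
  by rewrite -embM.
exact: upos_star_mul.
Qed.

End CstarPositivity.

(** * The inner product of a Hilbert module *)

Section InnerProduct.
Context {R : realType} {A : cstarAlgType R} {X : hilbertModType A}.
Implicit Types (x y w : X) (a : A).

Lemma hinnerDr x y w : hinner x (y + w) = hinner x y + hinner x w.
Proof. by have := hinner_linear 1 x y w; rewrite !scale1r. Qed.

Lemma hinner0r x : hinner x 0 = 0.
Proof. by apply: (@addrI _ (hinner x 0)); rewrite -hinnerDr !addr0. Qed.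

Lemma hinnerNr x y : hinner x (- y) = - hinner x y.
Proof. by apply: (@addrI _ (hinner x y)); rewrite -hinnerDr !subrr hinner0r. Qed.

Lemma hinner_sumr x (I : finType) (F : I -> X) :
  hinner x (\sum_i F i) = \sum_i hinner x (F i).
Proof. exact: (big_morph _ (hinnerDr x) (hinner0r x)). Qed.

Lemma hinnerDl x y w : hinner (x + y) w = hinner x w + hinner y w.
Proof. by rewrite -hinner_adj hinnerDr cadjD !hinner_adj. Qed.

Lemma hinnerNl x y : hinner (- x) y = - hinner x y.
Proof.
apply: (@addrI _ (hinner x y)).
by rewrite -hinnerDl !subrr -hinner_adj hinner0r cadj0.
Qed.

Lemma hinner_suml (I : finType) (F : I -> X) y :
  hinner (\sum_i F i) y = \sum_i hinner (F i) y.
Proof.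
apply: (big_morph (fun x => hinner x y)) => [x w|]; first exact: hinnerDl.
by rewrite -hinner_adj hinner0r cadj0.
Qed.

Lemma hinner_actl x a y : hinner (hact x a) y = cmul (cadj a) (hinner x y).
Proof. by rewrite -hinner_adj hinner_act cadjM hinner_adj. Qed.

(** By orthogonality [<e_i, y> = (1 - p_i) a_i]; then expand the first
    argument of [<y, y>]. *)
Lemma bessel_identity n (e : 'I_n -> X) x :
  (forall i j : 'I_n, i <> j -> hinner (e i) (e j) = 0) ->
  let a i := hinner (e i) x in
  let y := x - \sum_i hact (e i) (a i) in
  hinner x x - \sum_i cmul (cadj (a i)) (a i) =
  hinner y y + \sum_i cmul (cadj (a i)) (a i - cmul (hinner (e i) (e i)) (a i)).
Proof.
move=> orth a y.
have ey i : hinner (e i) y = a i - cmul (hinner (e i) (e i)) (a i).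
  rewrite hinnerDr hinnerNr hinner_sumr (bigD1 i) //= hinner_act big1 ?addr0 //.
  by move=> j /eqP ji; rewrite hinner_act orth ?cmul0r //; exact: nesym.
rewrite {1}/y hinnerDl hinnerNl hinner_suml.
under [X in _ - X + _]eq_bigr => i _ do rewrite hinner_actl ey.
rewrite subrK hinnerDr hinnerNr hinner_sumr; congr (_ - _).
by apply: eq_bigr => i _; rewrite hinner_act hinner_adj.
Qed.

End InnerProduct.

Theorem theorem3p1 (R : realType) (A : cstarAlgType R) (X : hilbertModType A)
  (n : nat) (e : 'I_n -> X)
  (e_unit : forall i : 'I_n, hnorm (e i) = 1)
  (e_orth : forall i j : 'I_n, i <> j -> hinner (e i) (e j) = 0)
  (x : X) :
  cle (\sum_(i < n) csqr (cabs (hinner (e i) x))) (csqr (habs x)).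
Proof.
rewrite (csqr_csqrt (hinner_ge0 x)).
under eq_bigr => i _ do rewrite (csqr_csqrt (cpositive_star_mul _)).
split.
- have pos i := cpositive_star_mul (hinner (e i) x).
  by case: (cpositive_sum (index_enum _) pos).
- by case: (hinner_ge0 x).
rewrite (bessel_identity _ e_orth); apply: cpositiveD; first exact: hinner_ge0.
apply: cpositive_sum => i; apply: cpositive_contraction; first exact: hinner_adj.
by rewrite -[`|_|]sqrtCK -/(hnorm (e i)) e_unit expr1n.
Qed.
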